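(* Let $A\in\mathbb R$. The matrix Schrödinger operator $L=-D_x^2+U(x)$ with the $\pi$-periodic potential $$U(x)=A\begin{pmatrix}\cos 2x&\sin 2x\\ \sin 2x&-\cos 2x\end{pmatrix}$$ is a maximally finite-gap operator, with the eigenfunctions (solutions of $L\psi=\lambda\psi$) explicitly expressed in elementary functions.
   Context: $D_x=d/dx$, $x\in\mathbb R$, and $L$ acts on $\mathbb C^2$-valued functions. A Schrödinger operator $L=-D_x^2+U(x)$ with periodic real symmetric matrix potential is called maximally finite-gap if for all sufficiently large positive $\lambda$ all solutions of $L\psi=\lambda\psi$ are bounded on $\mathbb R$. *)

(* Defs.v *)
(* Stdlib real numbers with Coquelicot. *)
From Stdlib Require Import Reals List.
From Coquelicot Require Import Coquelicot.
Open Scope R_scope.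

Definition entry (M : @matrix R 2 2) (i j : nat) : R := coeff_mat 0 M i j.

Definition mat_act (M : @matrix R 2 2) (v : C * C) : C * C :=
  ((RtoC (entry M 0 0) * fst v + RtoC (entry M 0 1) * snd v)%C,
   (RtoC (entry M 1 0) * fst v + RtoC (entry M 1 1) * snd v)%C).

(* [psi] solves [- psi'' + U psi = lam psi] on the whole real line. *)
Definition solves_schrodinger (U : R -> @matrix R 2 2) (lam : C)
    (psi : R -> C * C) : Prop :=
  exists dpsi ddpsi : R -> C * C,
    (forall x : R, is_derive (K := R_AbsRing) psi x (dpsi x)) /\
    (forall x : R, is_derive (K := R_AbsRing) dpsi x (ddpsi x)) /\
    (forall x : R,
      (- fst (ddpsi x) + fst (mat_act (U x) (psi x)))%C
        = (lam * fst (psi x))%C /\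
      (- snd (ddpsi x) + snd (mat_act (U x) (psi x)))%C
        = (lam * snd (psi x))%C).

Definition bounded_on_R (psi : R -> C * C) : Prop :=
  exists M : R, forall x : R,
    Cmod (fst (psi x)) <= M /\ Cmod (snd (psi x)) <= M.

Definition periodic_potential (T : R) (U : R -> @matrix R 2 2) : Prop :=
  0 < T /\ forall x : R, U (x + T) = U x.

Definition symmetric_potential (U : R -> @matrix R 2 2) : Prop :=
  forall (x : R) (i j : nat), (i < 2)%nat -> (j < 2)%nat ->
    entry (U x) i j = entry (U x) j i.

Definition maximally_finite_gap (T : R) (U : R -> @matrix R 2 2) : Prop :=
  periodic_potential T U /\ symmetric_potential U /\
  exists lam0 : R, forall lam : R, 0 < lam -> lam0 < lam ->
    forall psi : R -> C * C,
      solves_schrodinger U (RtoC lam) psi -> bounded_on_R psi.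

Definition Cexp (z : C) : C :=
  (exp (Re z) * cos (Im z), exp (Re z) * sin (Im z)).

(* Elementary formulas in the variable x and the spectral parameter lambda.
   Since constants are complex, trigonometric functions and their inverses are
   obtained from [EExp] and [ELog], and radicals are e^(log(.)/n). *)
Inductive eformula : Type :=
  | EX : eformula
  | ELambda : eformula
  | EConst : C -> eformula
  | EAdd : eformula -> eformula -> eformula
  | EMul : eformula -> eformula -> eformula
  | EInv : eformula -> eformula
  | EExp : eformula -> eformula
  | ELog : eformula -> eformula.

(* [f] is a single-valued branch on the whole line, at the given value of
   lambda, of the possibly multivalued formula [e]. Formulas are never
   evaluated at a singularity: the argument of [EInv] must have no zero, and
   that of [ELog] must have a continuous logarithm (hence no zero either). *)
Fixpoint is_branch (e : eformula) (lam : C) (f : R -> C) : Prop :=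
  match e with
  | EX => forall x : R, f x = RtoC x
  | ELambda => forall x : R, f x = lam
  | EConst c => forall x : R, f x = c
  | EAdd e1 e2 => exists g h : R -> C,
      is_branch e1 lam g /\ is_branch e2 lam h /\
      forall x : R, f x = (g x + h x)%C
  | EMul e1 e2 => exists g h : R -> C,
      is_branch e1 lam g /\ is_branch e2 lam h /\
      forall x : R, f x = (g x * h x)%C
  | EInv e1 => exists g : R -> C,
      is_branch e1 lam g /\
      forall x : R, g x <> RtoC 0 /\ f x = (/ g x)%C
  | EExp e1 => exists g : R -> C,
      is_branch e1 lam g /\ forall x : R, f x = Cexp (g x)
  | ELog e1 => exists g : R -> C,
      is_branch e1 lam g /\
      (forall x : R, continuous f x) /\ forall x : R, Cexp (f x) = g x
  end.

Definition is_branch2 (E : eformula * eformula) (lam : C)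
    (psi : R -> C * C) : Prop :=
  is_branch (fst E) lam (fun x => fst (psi x)) /\
  is_branch (snd E) lam (fun x => snd (psi x)).

(* The solution space is 4-dimensional over C, so four spanning solutions form
   a basis of it. *)
Definition fundamental_system (U : R -> @matrix R 2 2) (lam : C)
    (Psi : nat -> R -> C * C) : Prop :=
  (forall k : nat, (k < 4)%nat -> solves_schrodinger U lam (Psi k)) /\
  forall psi : R -> C * C, solves_schrodinger U lam psi ->
    exists c : nat -> C, forall x : R,
      fst (psi x) = sum_n (fun k => (c k * fst (Psi k x))%C) 3 /\
      snd (psi x) = sum_n (fun k => (c k * snd (Psi k x))%C) 3.

(* At every lambda each solution is an elementary function of x. Moreover the
   dependence on lambda is explicit: four formulas in x and lambda give a
   fundamental system for all lambda outside a finite set, such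
   as the values where characteristic exponents collide and the generic
   formulas degenerate. *)
Definition elementary_eigenfunctions (U : R -> @matrix R 2 2) : Prop :=
  (forall (lam : C) (psi : R -> C * C), solves_schrodinger U lam psi ->
     exists E : eformula * eformula, is_branch2 E lam psi) /\
  exists (E : nat -> eformula * eformula) (exceptional : list C),
    forall lam : C, ~ In lam exceptional ->
      exists Psi : nat -> R -> C * C,
        (forall k : nat, (k < 4)%nat -> is_branch2 (E k) lam (Psi k)) /\
        fundamental_system U lam Psi.

Definition rotating_potential (A : R) (x : R) : @matrix R 2 2 :=
  [[ A * cos (2 * x), A * sin (2 * x) ],
   [ A * sin (2 * x), - (A * cos (2 * x)) ]].

(* Main.v *)
(* In the frame rotating with the potential, p = e^{-ix} (psi_1 + i psi_2) and
   q = e^{ix} (psi_1 - i psi_2), the equation L psi = lambda psi becomes a system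
   with constant coefficients. Eliminating either unknown gives
   f'''' + 2 (lambda + 1) f'' + ((lambda - 1)^2 - A^2) f = 0, whose characteristic
   exponents are +-a and +-b with a^2, b^2 = -(lambda + 1) +- sqrt (4 lambda + A^2).
   Solving four first-order equations in succession shows that every solution is
   an exponential polynomial. For lambda > 1 + |A| both a^2 and b^2 are negative
   and distinct, so all solutions are combinations of bounded exponentials. *)
Require Import Defs.
From Stdlib Require Import Reals List Lra Lia Classical.
From Coquelicot Require Import Coquelicot.
Open Scope R_scope.

(** * Derivatives of complex-valued functions *)

(** Used with [is_linear_inr] to reassemble a pair as (u, 0) + (0, v), so that componentwise
    derivatives give the derivative of the pair. *)
Lemma is_linear_inl (U V : NormedModule R_AbsRing) :
  is_linear (fun u : U => (u, zero) : prod_NormedModule R_AbsRing U V).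
Proof.
split.
- intros a b; exact (f_equal (pair (plus a b)) (eq_sym (plus_zero_l zero))).
- intros k a; exact (f_equal (pair (scal k a)) (eq_sym (scal_zero_r k))).
- exists 1; split; [lra|]; intros a.
  unfold norm at 1; cbn; unfold prod_norm; cbn; rewrite norm_zero.
  rewrite Rmult_1_l, !Rmult_1_r, Rmult_0_l, Rplus_0_r.
  rewrite sqrt_square by apply norm_ge_0; lra.
Qed.

Lemma is_linear_inr (U V : NormedModule R_AbsRing) :
  is_linear (fun v : V => (zero, v) : prod_NormedModule R_AbsRing U V).
Proof.
split.
- intros a b.
  exact (f_equal (fun z => (z, plus a b)) (eq_sym (plus_zero_l zero))).
- intros k a.
  exact (f_equal (fun z => (z, scal k a)) (eq_sym (scal_zero_r k))).
- exists 1; split; [lra|]; intros a.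
  unfold norm at 1; cbn; unfold prod_norm; cbn; rewrite norm_zero.
  rewrite Rmult_1_l, !Rmult_1_r, Rmult_0_l, Rplus_0_l.
  rewrite sqrt_square by apply norm_ge_0; lra.
Qed.

(** The chain rule, since a linear map is its own differential; it serves for the projections and
    injections of a product. *)
Lemma is_derive_linear (U V : NormedModule R_AbsRing) (l : U -> V)
  (f : R -> U) (x : R) (df : U) :
  is_linear l -> is_derive (K := R_AbsRing) f x df ->
  is_derive (K := R_AbsRing) (fun t => l (f t)) x (l df).
Proof.
intros Hl Hf.
apply filterdiff_ext_lin with (fun y : R => l (scal y df)).
- apply (filterdiff_comp' f l x _ l); [exact Hf|].
  now apply filterdiff_linear.
- intros y; exact (linear_scal l Hl y df).
Qed.

Lemma is_derive_pair (U V : NormedModule R_AbsRing) (f : R -> U * V) (x : R)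
  (df : U * V) :
  is_derive (K := R_AbsRing) f x df <->
  is_derive (K := R_AbsRing) (fun t => fst (f t)) x (fst df) /\
  is_derive (K := R_AbsRing) (fun t => snd (f t)) x (snd df).
Proof.
split.
- intros H; split.
  + exact (is_derive_linear (prod_NormedModule R_AbsRing U V) U fst f x df
             is_linear_fst H).
  + exact (is_derive_linear (prod_NormedModule R_AbsRing U V) V snd f x df
             is_linear_snd H).
- intros [H1 H2].
  apply (is_derive_linear _ _ _ _ _ _ (is_linear_inl U V)) in H1.
  apply (is_derive_linear _ _ _ _ _ _ (is_linear_inr U V)) in H2.
  pose proof (is_derive_plus _ _ _ _ _ H1 H2) as H; cbn in H.
  unfold plus in H; cbn in H; unfold prod_plus in H; cbn in H.
  rewrite plus_zero_r, plus_zero_l in H.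
  destruct df as [d1 d2]; cbn in H.
  eapply is_derive_ext; [|exact H]; intros t; cbn.
  rewrite plus_zero_r, plus_zero_l; now destruct (f t).
Qed.

Definition deriv (f df : R -> C) : Prop :=
  forall x : R, is_derive (K := R_AbsRing) f x (df x).

Lemma deriv_parts (f df : R -> C) :
  deriv f df <->
  (forall x : R, is_derive (fun t => Re (f t)) x (Re (df x))) /\
  (forall x : R, is_derive (fun t => Im (f t)) x (Im (df x))).
Proof.
split.
- intros H; split; intros x; now apply (is_derive_pair _ _ f x (df x)).
- intros [H1 H2] x; apply (is_derive_pair _ _ f x (df x)); split;
  [apply H1 | apply H2].
Qed.

Lemma deriv_ext (f g df dg : R -> C) :
  (forall x, f x = g x) -> (forall x, df x = dg x) -> deriv f df -> deriv g dg.
Proof.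
intros Hf Hd H x; rewrite <- Hd; eapply is_derive_ext; [exact Hf|apply H].
Qed.

Lemma deriv_const (c : C) : deriv (fun _ => c) (fun _ => RtoC 0).
Proof. intros x; exact (is_derive_const (K := R_AbsRing) c x). Qed.

Lemma deriv_plus (f g df dg : R -> C) :
  deriv f df -> deriv g dg ->
  deriv (fun x => f x + g x)%C (fun x => df x + dg x)%C.
Proof.
intros Hf Hg x; exact (is_derive_plus _ _ _ _ _ (Hf x) (Hg x)).
Qed.

(** The real product rule is applied to the four products that make up the real and imaginary
    parts. *)
Lemma deriv_mult (f g df dg : R -> C) :
  deriv f df -> deriv g dg ->
  deriv (fun x => f x * g x)%C (fun x => df x * g x + f x * dg x)%C.
Proof.
intros [Hf1 Hf2]%deriv_parts [Hg1 Hg2]%deriv_parts.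
apply deriv_parts; split; intros x; cbn.
- pose proof (is_derive_mult _ _ _ _ _ (Hf1 x) (Hg1 x) Rmult_comm) as H1.
  pose proof (is_derive_mult _ _ _ _ _ (Hf2 x) (Hg2 x) Rmult_comm) as H2.
  pose proof (is_derive_minus _ _ _ _ _ H1 H2) as H; cbn in H.
  unfold minus, plus, opp, mult in H; cbn in H.
  unfold Re, Im in *.
  match type of H with is_derive _ _ ?l =>
    match goal with |- is_derive _ _ ?m => replace m with l by ring end end.
  exact H.
- pose proof (is_derive_mult _ _ _ _ _ (Hf1 x) (Hg2 x) Rmult_comm) as H1.
  pose proof (is_derive_mult _ _ _ _ _ (Hf2 x) (Hg1 x) Rmult_comm) as H2.
  pose proof (is_derive_plus _ _ _ _ _ H1 H2) as H; cbn in H.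
  unfold minus, plus, opp, mult in H; cbn in H.
  unfold Re, Im in *.
  match type of H with is_derive _ _ ?l =>
    match goal with |- is_derive _ _ ?m => replace m with l by ring end end.
  exact H.
Qed.

Lemma deriv_scal (c : C) (f df : R -> C) :
  deriv f df -> deriv (fun x => c * f x)%C (fun x => c * df x)%C.
Proof.
intros H.
eapply deriv_ext; [ | |exact (deriv_mult _ _ _ _ (deriv_const c) H)].
- reflexivity.
- intros x; cbn beta; ring.
Qed.

Lemma deriv_Cexp (k : C) :
  deriv (fun x => Cexp (k * RtoC x)) (fun x => k * Cexp (k * RtoC x))%C.
Proof.
apply deriv_parts; destruct k as [u v]; split; intros x; cbn;
  auto_derive; trivial; unfold Rminus; ring.
Qed.

Lemma deriv_zero_const (f : R -> C) :
  deriv f (fun _ => RtoC 0) -> forall x, f x = f 0.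
Proof.
intros H x; destruct (Rtotal_order x 0) as [Hx|[->|Hx]]; trivial.
- apply (eq_is_derive f x 0); trivial; intros t _; apply H.
- symmetry; apply (eq_is_derive f 0 x); trivial; intros t _; apply H.
Qed.

(** * Complex exponentials, logarithms and square roots *)

Lemma Cexp_plus (z w : C) : Cexp (z + w) = (Cexp z * Cexp w)%C.
Proof.
destruct z as [a b], w as [c d]; unfold Cexp, Cmult; cbn.
rewrite exp_plus, cos_plus, sin_plus; f_equal; ring.
Qed.

Lemma Cexp_0 : Cexp (RtoC 0) = RtoC 1.
Proof. unfold Cexp, RtoC; cbn; rewrite exp_0, cos_0, sin_0; f_equal; ring. Qed.

Lemma Cexp_opp (z w : C) : (z + w = 0)%C -> (Cexp z * Cexp w = 1)%C.
Proof. intros H; now rewrite <- Cexp_plus, H, Cexp_0. Qed.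

Lemma Cmod_Cexp_imag (z : C) : Re z = 0 -> Cmod (Cexp z) = 1.
Proof.
destruct z as [s t]; cbn; intros ->.
unfold Cmod, Cexp; cbn -[pow]; rewrite exp_0, !Rmult_1_l.
replace (cos t ^ 2 + sin t ^ 2) with 1; [apply sqrt_1|].
pose proof (sin2_cos2 t) as H; unfold Rsqr in H; lra.
Qed.

(** Polar form: the real part is the logarithm of the modulus, the imaginary part an angle recovered
    by [acos]. *)
Lemma Clog_exists (w : C) : w <> RtoC 0 -> exists z : C, Cexp z = w.
Proof.
intros Hw; pose proof (Cmod_gt_0 w) as [Hr _]; specialize (Hr Hw).
set (r := Cmod w) in *; destruct w as [a b].
assert (Hab : a * a + b * b = r * r).
{ unfold r, Cmod; cbn -[pow]; rewrite sqrt_sqrt by nra; ring. }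
assert (H1 : (a / r) * (a / r) + (b / r) * (b / r) = 1).
{ transitivity ((a * a + b * b) / (r * r)); [field; lra|].
  rewrite Hab; field; lra. }
assert (Hth : exists th, cos th = a / r /\ sin th = b / r).
{ set (u := a / r) in *; set (v := b / r) in *.
  assert (Hu : -1 <= u <= 1) by nra.
  (* [acos] takes values in [0, pi], so the sign of the angle must follow that of the imaginary
     part. *)
  destruct (Rle_dec 0 v) as [Hv|Hv].
  - exists (acos u); rewrite cos_acos, sin_acos by lra; split; trivial.
    unfold Rsqr; replace (1 - u * u) with (v * v) by lra.
    now apply sqrt_square.
  - exists (- acos u); rewrite cos_neg, sin_neg, cos_acos, sin_acos by lra.
    split; trivial.
    unfold Rsqr; replace (1 - u * u) with ((- v) * (- v)) by lra.
    rewrite sqrt_square; lra. }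
destruct Hth as [th [Hc Hs]].
exists (ln r, th); unfold Cexp; cbn; rewrite exp_ln, Hc, Hs by trivial.
f_equal; field; lra.
Qed.

Lemma Cexp_half_sqr (z : C) :
  (Cexp (RtoC (1/2) * z) * Cexp (RtoC (1/2) * z) = Cexp z)%C.
Proof.
rewrite <- Cexp_plus; f_equal.
destruct z as [a b]; unfold Cmult, Cplus; cbn; f_equal; field.
Qed.

Lemma Csqrt_exists (w : C) : exists a : C, (a * a = w)%C.
Proof.
(* Zero has no logarithm; elsewhere a root is the exponential of half a logarithm. *)
destruct (classic (w = RtoC 0)) as [->|Hw].
- exists (RtoC 0); ring.
- destruct (Clog_exists w Hw) as [z <-].
  exists (Cexp (RtoC (1/2) * z)); apply Cexp_half_sqr.
Qed.

Lemma deriv_unique (f d1 d2 : R -> C) :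
  deriv f d1 -> deriv f d2 -> forall x, d1 x = d2 x.
Proof.
intros [H1 H2]%deriv_parts [H3 H4]%deriv_parts x.
rewrite (surjective_pairing (d1 x)), (surjective_pairing (d2 x)); f_equal.
- etransitivity; [symmetry|]; apply is_derive_unique; [apply H1 | apply H3].
- etransitivity; [symmetry|]; apply is_derive_unique; [apply H2 | apply H4].
Qed.

Lemma deriv_pow (n : nat) :
  deriv (fun x => RtoC (x ^ S n)) (fun x => RtoC (INR (S n)) * RtoC (x ^ n))%C.
Proof.
apply deriv_parts; split; intros x; unfold Re, Im; cbn -[INR pow];
  auto_derive; trivial; simpl INR; ring.
Qed.

(** * Exponential polynomials and constant-coefficient equations *)

(** Closure under pointwise equality is built in as a constructor, standing in for functional
    extensionality. *)
Inductive exp_poly : (R -> C) -> Prop :=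
| exp_poly_mono (c : C) (n : nat) (k : C) :
    exp_poly (fun x => c * RtoC (x ^ n) * Cexp (k * RtoC x))%C
| exp_poly_plus (f g : R -> C) :
    exp_poly f -> exp_poly g -> exp_poly (fun x => f x + g x)%C
| exp_poly_ext (f g : R -> C) :
    (forall x, f x = g x) -> exp_poly f -> exp_poly g.

Lemma exp_poly_const (c : C) : exp_poly (fun _ => c).
Proof.
apply exp_poly_ext with (2 := exp_poly_mono c 0 (RtoC 0)); intros x.
replace (RtoC 0 * RtoC x)%C with (RtoC 0) by ring; rewrite Cexp_0; cbn; ring.
Qed.

(** An exponential factor shifts every exponent by [k]. This provides the integrating factors and
    the return from the rotating frame. *)
Lemma exp_poly_scal_exp (c k : C) (f : R -> C) :
  exp_poly f -> exp_poly (fun x => c * Cexp (k * RtoC x) * f x)%C.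
Proof.
induction 1 as [d n l|f g _ IHf _ IHg|f g Hfg _ IH].
- apply exp_poly_ext with (2 := exp_poly_mono (c * d)%C n (k + l)%C); intros x.
  replace ((k + l) * RtoC x)%C with (k * RtoC x + l * RtoC x)%C by ring.
  rewrite Cexp_plus; ring.
- apply exp_poly_ext with (2 := exp_poly_plus _ _ IHf IHg); intros x; ring.
- apply exp_poly_ext with (2 := IH); intros x; now rewrite Hfg.
Qed.

Lemma exp_poly_scal (c : C) (f : R -> C) :
  exp_poly f -> exp_poly (fun x => c * f x)%C.
Proof.
intros H; apply exp_poly_ext with (2 := exp_poly_scal_exp c (RtoC 0) f H).
intros x; replace (RtoC 0 * RtoC x)%C with (RtoC 0) by ring.
rewrite Cexp_0; ring.
Qed.

Lemma RtoC_INR_S_neq_0 (n : nat) : RtoC (INR (S n)) <> RtoC 0.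
Proof. intros H; apply RtoC_inj in H; now apply (not_0_INR (S n)). Qed.

(** Integration by parts lowers the power of x one step at a time; for a zero exponent the power
    rises instead. *)
Lemma exp_mono_antiderivative (n : nat) (k : C) :
  exists F : R -> C,
    deriv F (fun x => RtoC (x ^ n) * Cexp (k * RtoC x))%C /\ exp_poly F.
Proof.
destruct (classic (k = RtoC 0)) as [->|Hk].
{ exists (fun x => / RtoC (INR (S n)) * RtoC (x ^ S n) * Cexp (RtoC 0 * RtoC x))%C.
  split; [|apply exp_poly_mono].
  eapply deriv_ext;
    [| |exact (deriv_scal (/ RtoC (INR (S n))) _ _ (deriv_pow n))];
    intros x; cbn beta; replace (RtoC 0 * RtoC x)%C with (RtoC 0) by ring;
    rewrite Cexp_0; [ring|field; apply RtoC_INR_S_neq_0]. }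
induction n as [|n [F [HF HE]]].
- exists (fun x => / k * RtoC (x ^ 0) * Cexp (k * RtoC x))%C.
  split; [|apply exp_poly_mono].
  eapply deriv_ext; [| |exact (deriv_scal (/ k) _ _ (deriv_Cexp k))];
    intros x; cbn; [ring|now field].
(* Integration by parts: x^(n+1) e^(kx) / k minus (n+1)/k times the antiderivative of x^n e^(kx). *)
- exists (fun x => / k * RtoC (x ^ S n) * Cexp (k * RtoC x)
                   + - (RtoC (INR (S n)) / k) * F x)%C.
  split; [|apply exp_poly_plus; [apply exp_poly_mono|now apply exp_poly_scal]].
  pose proof (deriv_mult _ _ _ _ (deriv_pow n) (deriv_Cexp k)) as H.
  apply (deriv_scal (/ k)) in H.
  apply (deriv_scal (- (RtoC (INR (S n)) / k))%C) in HF.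
  eapply deriv_ext; [| |exact (deriv_plus _ _ _ _ H HF)];
    intros x; cbn beta; [ring|now field].
Qed.

Lemma exp_poly_antiderivative (f : R -> C) :
  exp_poly f -> exists F : R -> C, deriv F f /\ exp_poly F.
Proof.
induction 1 as [c n k|f g _ [F [HF EF]] _ [G [HG EG]]|f g Hfg _ [F [HF EF]]].
- destruct (exp_mono_antiderivative n k) as [F [HF EF]].
  exists (fun x => c * F x)%C; split; [|now apply exp_poly_scal].
  eapply deriv_ext; [| |exact (deriv_scal c _ _ HF)]; intros x; cbn beta; ring.
- exists (fun x => F x + G x)%C; split.
  + now apply deriv_plus.
  + now apply exp_poly_plus.
- exists F; split; trivial.
  eapply deriv_ext; [| |exact HF]; trivial.
Qed.

(** Variation of constants: e^(-kx) f - G has zero derivative. The factors 1 match the shape of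
    [exp_poly_scal_exp]. *)
Lemma first_order_ode (k : C) (f df g G : R -> C) :
  deriv f df -> (forall x, df x = k * f x + g x)%C ->
  deriv G (fun x => 1 * Cexp (- k * RtoC x) * g x)%C ->
  exists c : C, forall x, f x = (1 * Cexp (k * RtoC x) * (c + G x))%C.
Proof.
intros Hf Hdf HG.
assert (Hinv : forall x, (Cexp (k * RtoC x) * Cexp (- k * RtoC x) = 1)%C).
{ intros x; apply Cexp_opp; ring. }
pose proof (deriv_mult _ _ _ _ (deriv_Cexp (- k)%C) Hf) as H.
pose proof (deriv_plus _ _ _ _ H (deriv_scal (- RtoC 1)%C _ _ HG)) as H'.
assert (H0 : deriv (fun x => Cexp (- k * RtoC x) * f x + - RtoC 1 * G x)%C
               (fun _ => RtoC 0)).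
{ eapply deriv_ext; [| |exact H']; intros x; cbn beta; trivial.
  rewrite Hdf; ring. }
pose proof (deriv_zero_const _ H0) as Hc; cbn beta in Hc.
(* The constant is read off at x = 0. *)
exists (Cexp (- k * RtoC 0) * f 0 + - RtoC 1 * G 0)%C; intros x.
rewrite <- (Hc x).
transitivity (f x * (Cexp (k * RtoC x) * Cexp (- k * RtoC x)))%C; [|ring].
rewrite Hinv; ring.
Qed.

(** Resonance between [k] and an exponent of [g] only adds powers of x, so the class is closed under
    solving such equations. *)
Lemma exp_poly_ode (k : C) (f df g : R -> C) :
  deriv f df -> (forall x, df x = k * f x + g x)%C -> exp_poly g -> exp_poly f.
Proof.
intros Hf Hdf Hg.
destruct (exp_poly_antiderivative _ (exp_poly_scal_exp 1 (- k)%C g Hg))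
  as [G [HG EG]].
destruct (first_order_ode k f df g G Hf Hdf HG) as [c Hc].
apply exp_poly_ext with (1 := fun x => eq_sym (Hc x)).
apply exp_poly_scal_exp, exp_poly_plus; trivial; apply exp_poly_const.
Qed.

Lemma exp_ode (k : C) (f df : R -> C) :
  deriv f df -> (forall x, df x = k * f x)%C ->
  exists c : C, forall x, f x = (c * Cexp (k * RtoC x))%C.
Proof.
intros Hf Hdf.
destruct (first_order_ode k f df (fun _ => RtoC 0) (fun _ => RtoC 0) Hf)
  as [c Hc].
- intros x; rewrite Hdf; ring.
- eapply deriv_ext; [| |exact (deriv_const 0)]; intros x; cbn beta; ring.
- exists c; intros x; rewrite Hc; ring.
Qed.

(** * Biquadratic equations with characteristic exponents +-a and +-b *)

Definition biquadratic_ode (c2 c0 : C) (f : R -> C) : Prop :=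
  exists f1 f2 f3 : R -> C,
    deriv f f1 /\ deriv f1 f2 /\ deriv f2 f3 /\
    deriv f3 (fun x => - c2 * f2 x - c0 * f x)%C.

(** The operator factors as (D - a)(D + a)(D - b)(D + b), and the factors are inverted one at a
    time. Exponents may coincide, at the price of powers of x. *)
Lemma biquadratic_exp_poly (a b : C) (f : R -> C) :
  biquadratic_ode (- (a * a + b * b)) (a * a * (b * b)) f -> exp_poly f.
Proof.
intros (f1 & f2 & f3 & D1 & D2 & D3 & D4).
pose proof (deriv_plus _ _ _ _ D2 (deriv_scal (- a)%C _ _ D1)) as E1.
pose proof (deriv_plus _ _ _ _ D3 (deriv_scal (- (a * a))%C _ _ D1)) as E2.
pose proof (deriv_plus _ _ _ _ D4 (deriv_scal (- (a * a))%C _ _ D2)) as E3.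
pose proof (deriv_plus _ _ _ _ E3 (deriv_scal (- b)%C _ _ E2)) as E4.
(* f solves an equation with exponent a and source (D - a) f, which in turn solves one with exponent
   -a and source (D^2 - a^2) f. *)
apply (exp_poly_ode a _ _ (fun x => f1 x + - a * f x)%C D1); [intros x; ring|].
pose proof (deriv_plus _ _ _ _ D2 (deriv_scal (- a)%C _ _ D1)) as F1.
apply (exp_poly_ode (- a)%C _ _ (fun x => f2 x + - (a * a) * f x)%C F1);
  [intros x; ring|].
eapply (exp_poly_ode b _ _ _ E2); [intros x; symmetry; cbn beta|].
(* The next source is (D - b)(D^2 - a^2) f, annihilated by D + b according to the full equation. *)
- instantiate (1 := fun x => (f3 x + - (a * a) * f1 x
                              + - b * (f2 x + - (a * a) * f x))%C).
  cbn beta; ring.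
- apply (exp_poly_ode (- b)%C _ _ (fun _ => RtoC 0) E4);
    [intros x; ring|apply exp_poly_const].
Qed.

(** Let P(z) = z^4 + c2 z^2 + c0. Since P(k) = 0, the left side is Q(D) f for the quotient Q(z) =
    P(z) / (z - k); as (D - k) Q(D) f = 0, it is a multiple of e^(kx). *)
Lemma biquadratic_exp (c2 c0 k : C) (f f1 f2 f3 : R -> C) :
  deriv f f1 -> deriv f1 f2 -> deriv f2 f3 ->
  deriv f3 (fun x => - c2 * f2 x - c0 * f x)%C ->
  (k * k * (k * k) + c2 * (k * k) + c0 = 0)%C ->
  exists c : C, forall x,
    (f3 x + k * f2 x + (k * k + c2) * f1 x + (k * k * k + c2 * k) * f x
      = c * Cexp (k * RtoC x))%C.
Proof.
intros D1 D2 D3 D4 Hk.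
pose proof (deriv_plus _ _ _ _ (deriv_plus _ _ _ _ (deriv_plus _ _ _ _ D4
  (deriv_scal k _ _ D3)) (deriv_scal (k * k + c2)%C _ _ D2))
  (deriv_scal (k * k * k + c2 * k)%C _ _ D1)) as H.
apply (exp_ode k _ _ H); intros x; cbn beta.
(* Solving P(k) = 0 for [c0] leaves a polynomial identity. *)
assert (E : c0 = (- (k * k * (k * k)) - c2 * (k * k))%C).
{ transitivity ((k * k * (k * k) + c2 * (k * k) + c0)
                - (k * k * (k * k)) - c2 * (k * k))%C; [ring|].
  rewrite Hk; ring. }
rewrite E; ring.
Qed.

Definition exponent (a b : C) (k : nat) : C :=
  match k with 0 => a | 1 => - a | 2 => b | _ => - b end%C.

Lemma sum_n_3 (u : nat -> C) :
  sum_n u 3 = (u 0%nat + u 1%nat + u 2%nat + u 3%nat)%C.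
Proof. now rewrite !sum_Sn, sum_O. Qed.

Lemma Cminus_neq_0 (z w : C) : z <> w -> (z - w)%C <> RtoC 0.
Proof.
intros H E; apply H.
transitivity (z - w + w)%C; [ring|]; rewrite E; ring.
Qed.

(** Lagrange interpolation of the constant 1 at the four simple roots of P: the sum over the roots k
    of P(z) / ((z - k) P'(k)) is 1. Hence f is a combination of the four multiples of exponentials
    given by [biquadratic_exp]. *)
Lemma biquadratic_exp_sum (a b : C) (f : R -> C) :
  a <> RtoC 0 -> b <> RtoC 0 -> (a * a)%C <> (b * b)%C ->
  biquadratic_ode (- (a * a + b * b)) (a * a * (b * b)) f ->
  exists c : nat -> C, forall x,
    f x = sum_n (fun k => c k * Cexp (exponent a b k * RtoC x))%C 3.
Proof.
intros Ha Hb Hab%Cminus_neq_0 (f1 & f2 & f3 & D1 & D2 & D3 & D4).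
destruct (biquadratic_exp _ _ a f f1 f2 f3 D1 D2 D3 D4) as [u1 H1]; [ring|].
destruct (biquadratic_exp _ _ (- a)%C f f1 f2 f3 D1 D2 D3 D4) as [u2 H2]; [ring|].
destruct (biquadratic_exp _ _ b f f1 f2 f3 D1 D2 D3 D4) as [u3 H3]; [ring|].
destruct (biquadratic_exp _ _ (- b)%C f f1 f2 f3 D1 D2 D3 D4) as [u4 H4]; [ring|].
(* The weights are 1 / P'(k), with P'(a) = 2a(a^2 - b^2), P'(b) = -2b(a^2 - b^2), and opposite signs
   at -a and -b. *)
exists (fun k => match k with
  | 0 => u1 / (2 * a * (a * a - b * b))
  | 1 => - u2 / (2 * a * (a * a - b * b))
  | 2 => - u3 / (2 * b * (a * a - b * b))
  | _ => u4 / (2 * b * (a * a - b * b)) end%C).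
intros x; rewrite sum_n_3; unfold exponent.
transitivity ((u1 * Cexp (a * RtoC x)) / (2 * a * (a * a - b * b))
  - (u2 * Cexp (- a * RtoC x)) / (2 * a * (a * a - b * b))
  - (u3 * Cexp (b * RtoC x)) / (2 * b * (a * a - b * b))
  + (u4 * Cexp (- b * RtoC x)) / (2 * b * (a * a - b * b)))%C.
- rewrite <- H1, <- H2, <- H3, <- H4.
  field; repeat split; trivial; intros E%RtoC_inj; lra.
- field; repeat split; trivial; intros E%RtoC_inj; lra.
Qed.

(** * Exponential polynomials as elementary formulas *)

Definition elementary (lam : C) (f : R -> C) : Prop :=
  exists e : eformula, is_branch e lam f.

Lemma elementary_const (lam c : C) : elementary lam (fun _ => c).
Proof. now exists (EConst c). Qed.

Lemma elementary_plus (lam : C) (f g h : R -> C) :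
  elementary lam f -> elementary lam g -> (forall x, h x = f x + g x)%C ->
  elementary lam h.
Proof. intros [e1 H1] [e2 H2] H; exists (EAdd e1 e2), f, g; auto. Qed.

Lemma elementary_mult (lam : C) (f g h : R -> C) :
  elementary lam f -> elementary lam g -> (forall x, h x = f x * g x)%C ->
  elementary lam h.
Proof. intros [e1 H1] [e2 H2] H; exists (EMul e1 e2), f, g; auto. Qed.

Lemma elementary_pow (lam : C) (n : nat) : elementary lam (fun x => RtoC (x ^ n)).
Proof.
induction n as [|n IH].
- exact (elementary_const lam 1).
- apply elementary_mult with (f := RtoC) (2 := IH).
  + now exists EX.
  + intros x; cbn; now rewrite RtoC_mult.
Qed.

Lemma elementary_exp (lam k : C) : elementary lam (fun x => Cexp (k * RtoC x)).
Proof.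
exists (EExp (EMul (EConst k) EX)), (fun x => k * RtoC x)%C; split; trivial.
now exists (fun _ => k), RtoC.
Qed.

(** Exponents and coefficients enter as constants, so the formula may change with [lam]; this serves
    the claim about each single value of [lam]. *)
Lemma exp_poly_elementary (lam : C) (f : R -> C) : exp_poly f -> elementary lam f.
Proof.
induction 1 as [c n k|f g _ IHf _ IHg|f g Hfg _ IH].
- apply elementary_mult with (2 := elementary_exp lam k)
    (f := fun x => (c * RtoC (x ^ n))%C); trivial.
  apply elementary_mult with (1 := elementary_const lam c)
    (2 := elementary_pow lam n); trivial.
- now apply elementary_plus with (1 := IHf) (2 := IHg).
(* Adding the constant zero passes to a pointwise equal function. *)
- apply elementary_plus with (1 := IH) (2 := elementary_const lam 0).
  intros x; rewrite <- Hfg; ring.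
Qed.

(** * The rotating frame *)

(** Reduces the vector equation to scalar chains of [deriv], with the second derivatives
    isolated. *)
Lemma solves_rotating_iff (A : R) (lam : C) (psi : R -> C * C) :
  solves_schrodinger (rotating_potential A) lam psi <->
  exists u1 u2 v1 v2 : R -> C,
    deriv (fun x => fst (psi x)) u1 /\ deriv u1 u2 /\
    deriv (fun x => snd (psi x)) v1 /\ deriv v1 v2 /\
    forall x,
      u2 x = (RtoC (A * cos (2 * x)) * fst (psi x)
              + RtoC (A * sin (2 * x)) * snd (psi x) - lam * fst (psi x))%C /\
      v2 x = (RtoC (A * sin (2 * x)) * fst (psi x)
              - RtoC (A * cos (2 * x)) * snd (psi x) - lam * snd (psi x))%C.
Proof.
split.
- intros (d & dd & H1 & H2 & H).
  exists (fun x => fst (d x)), (fun x => fst (dd x)),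
    (fun x => snd (d x)), (fun x => snd (dd x)).
  split; [intros x; apply (is_derive_pair _ _ psi x (d x)), H1|].
  split; [intros x; apply (is_derive_pair _ _ d x (dd x)), H2|].
  split; [intros x; apply (is_derive_pair _ _ psi x (d x)), H1|].
  split; [intros x; apply (is_derive_pair _ _ d x (dd x)), H2|].
  intros x; destruct (H x) as [E1 E2]; rewrite <- E1, <- E2.
  unfold mat_act, rotating_potential, entry; cbn.
  rewrite RtoC_opp; split; ring.
- intros (u1 & u2 & v1 & v2 & D1 & D2 & D3 & D4 & H).
  exists (fun x => (u1 x, v1 x)), (fun x => (u2 x, v2 x)).
  split; [intros x; apply (is_derive_pair _ _ psi x); split; [apply D1|apply D3]|].
  split; [intros x; apply (is_derive_pair C_R_NormedModule C_R_NormedModule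
            (fun x => (u1 x, v1 x)) x); split; [apply D2|apply D4]|].
  intros x; destruct (H x) as [E1 E2]; cbn [fst snd]; rewrite E1, E2.
  unfold mat_act, rotating_potential, entry; cbn.
  rewrite RtoC_opp; split; ring.
Qed.

(** The equation in the rotating frame is the case [e] = i. A general [e] makes the interchange of p
    and q a change of sign of [e]. *)
Definition rotated_system (e A lam : C) (p q : R -> C) : Prop :=
  exists p1 p2 q1 q2 : R -> C,
    deriv p p1 /\ deriv p1 p2 /\ deriv q q1 /\ deriv q1 q2 /\
    (forall x, p2 x = - (2 * e) * p1 x + (1 - lam) * p x + A * q x)%C /\
    (forall x, q2 x = 2 * e * q1 x + (1 - lam) * q x + A * p x)%C.

Lemma rotated_system_sym (e A lam : C) (p q : R -> C) :
  rotated_system e A lam p q -> rotated_system (- e)%C A lam q p.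
Proof.
intros (p1 & p2 & q1 & q2 & D1 & D2 & D3 & D4 & H1 & H2).
exists q1, q2, p1, p2; do 4 (split; [assumption|]).
split; intros x; [rewrite H2|rewrite H1]; ring.
Qed.

(** Once the equation for p'' is differentiated twice, the claim is a polynomial identity in p, p',
    q, q' modulo e^2 = -1. Nothing is divided by [A], so [A] = 0 is included. *)
Lemma rotated_system_biquadratic (e A lam : C) (p q : R -> C) :
  (e * e = - 1)%C -> rotated_system e A lam p q ->
  biquadratic_ode (2 * (lam + 1))%C ((lam - 1) * (lam - 1) - A * A)%C p.
Proof.
intros He (p1 & p2 & q1 & q2 & D1 & D2 & D3 & D4 & H1 & H2).
set (p3 := fun x => (- (2 * e) * p2 x + (1 - lam) * p1 x + A * q1 x)%C).
assert (D : deriv p2 p3).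
{ eapply deriv_ext; [intros x; symmetry; apply H1| |
    exact (deriv_plus _ _ _ _ (deriv_plus _ _ _ _
      (deriv_scal (- (2 * e))%C _ _ D2) (deriv_scal (1 - lam)%C _ _ D1))
      (deriv_scal A _ _ D3))]; reflexivity. }
exists p1, p2, p3; split; [|split; [|split]]; trivial.
eapply deriv_ext; [| |
    exact (deriv_plus _ _ _ _ (deriv_plus _ _ _ _
      (deriv_scal (- (2 * e))%C _ _ D) (deriv_scal (1 - lam)%C _ _ D2))
      (deriv_scal A _ _ D4))]; [reflexivity|].
intros x; cbn beta; unfold p3; rewrite H2, H1; ring [He].
Qed.

(** The inverse of the passage to the rotating frame; the factors -i and i are 1/i and -1/i. *)
Definition unrotate (p q : R -> C) (x : R) : C * C :=
  (RtoC (1/2) * (Cexp (Ci * RtoC x) * p x + Cexp (- Ci * RtoC x) * q x),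
   RtoC (1/2) * (- Ci * Cexp (Ci * RtoC x) * p x
                 + Ci * Cexp (- Ci * RtoC x) * q x))%C.

Lemma Ci_sqr : (Ci * Ci = - 1)%C.
Proof. unfold Ci, Cmult, Copp, RtoC; cbn; f_equal; ring. Qed.

Lemma RtoC_half : (RtoC (1/2) * 2 = 1)%C.
Proof. rewrite <- RtoC_mult; f_equal; field. Qed.

Lemma Cexp_Ci_opp (x : R) : (Cexp (Ci * RtoC x) * Cexp (- Ci * RtoC x) = 1)%C.
Proof. apply Cexp_opp; ring. Qed.

(** Euler's formula, written with e^(ix) and e^(-ix) so that later computations can treat these as
    two indeterminates with product 1. *)
Lemma cos_double_Cexp (x : R) :
  RtoC (cos (2 * x)) = (RtoC (1/2) * (Cexp (Ci * RtoC x) * Cexp (Ci * RtoC x)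
    + Cexp (- Ci * RtoC x) * Cexp (- Ci * RtoC x)))%C.
Proof.
unfold Cexp, Ci, RtoC, Cmult, Cplus, Copp; cbn.
replace (0 * x - 1 * 0) with 0 by ring.
replace (-0 * x - -(1) * 0) with 0 by ring.
replace (0 * 0 + 1 * x) with x by ring.
replace (-0 * 0 + -(1) * x) with (- x) by ring.
rewrite exp_0, cos_neg, sin_neg, cos_2a; f_equal; field.
Qed.

Lemma sin_double_Cexp (x : R) :
  RtoC (sin (2 * x)) = (RtoC (1/2) * (- Ci * Cexp (Ci * RtoC x) * Cexp (Ci * RtoC x)
    + Ci * Cexp (- Ci * RtoC x) * Cexp (- Ci * RtoC x)))%C.
Proof.
unfold Cexp, Ci, RtoC, Cmult, Cplus, Copp; cbn.
replace (0 * x - 1 * 0) with 0 by ring.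
replace (-0 * x - -(1) * 0) with 0 by ring.
replace (0 * 0 + 1 * x) with x by ring.
replace (-0 * 0 + -(1) * x) with (- x) by ring.
rewrite exp_0, cos_neg, sin_neg, sin_2a; f_equal; field.
Qed.

(** Conjugation by e^(kx) turns D into D + k, hence D^2 into (D + k)^2. *)
Lemma deriv2_exp_mult (k : C) (f f1 f2 : R -> C) :
  deriv f f1 -> deriv f1 f2 ->
  deriv (fun x => Cexp (k * RtoC x) * f x)%C
    (fun x => Cexp (k * RtoC x) * (f1 x + k * f x))%C /\
  deriv (fun x => Cexp (k * RtoC x) * (f1 x + k * f x))%C
    (fun x => Cexp (k * RtoC x) * (f2 x + 2 * k * f1 x + k * k * f x))%C.
Proof.
intros D1 D2; split.
- eapply deriv_ext; [| |exact (deriv_mult _ _ _ _ (deriv_Cexp k) D1)];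
    intros x; cbn beta; ring.
- eapply deriv_ext; [| |exact (deriv_mult _ _ _ _ (deriv_Cexp k)
    (deriv_plus _ _ _ _ D2 (deriv_scal k _ _ D1)))]; intros x; cbn beta; ring.
Qed.

Lemma solves_rotated (A : R) (lam : C) (psi : R -> C * C) :
  solves_schrodinger (rotating_potential A) lam psi ->
  exists p q : R -> C, rotated_system Ci (RtoC A) lam p q /\
    forall x, psi x = unrotate p q x.
Proof.
intros (u1 & u2 & v1 & v2 & D1 & D2 & D3 & D4 & H)%solves_rotating_iff.
(* In the combinations psi_1 +- i psi_2 the potential becomes off-diagonal: (U psi)_1 + i (U psi)_2
   = A e^(2ix) (psi_1 - i psi_2), and likewise with i replaced by -i. *)
pose proof (deriv_plus _ _ _ _ D1 (deriv_scal Ci _ _ D3)) as Z1.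
pose proof (deriv_plus _ _ _ _ D2 (deriv_scal Ci _ _ D4)) as Z2.
pose proof (deriv_plus _ _ _ _ D1 (deriv_scal (- Ci)%C _ _ D3)) as W1.
pose proof (deriv_plus _ _ _ _ D2 (deriv_scal (- Ci)%C _ _ D4)) as W2.
destruct (deriv2_exp_mult (- Ci)%C _ _ _ Z1 Z2) as [P1 P2].
destruct (deriv2_exp_mult Ci _ _ _ W1 W2) as [Q1 Q2].
do 2 eexists; split; [do 4 eexists; split; [exact P1|split; [exact P2|
  split; [exact Q1|split; [exact Q2|]]]]; split|]; intros x; cbn beta.
- destruct (H x) as [-> ->]; rewrite !RtoC_mult, cos_double_Cexp, sin_double_Cexp.
  pose proof (Cexp_Ci_opp x) as HE.
  set (E := Cexp (Ci * RtoC x)) in *; set (F := Cexp (- Ci * RtoC x)) in *.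
  (* With [E] and [F] as indeterminates, only i^2 = -1, E F = 1 and (1/2) 2 = 1 are left to use. *)
  ring [Ci_sqr HE RtoC_half].
- destruct (H x) as [-> ->]; rewrite !RtoC_mult, cos_double_Cexp, sin_double_Cexp.
  pose proof (Cexp_Ci_opp x) as HE.
  set (E := Cexp (Ci * RtoC x)) in *; set (F := Cexp (- Ci * RtoC x)) in *.
  ring [Ci_sqr HE RtoC_half].
- unfold unrotate; pose proof (Cexp_Ci_opp x) as HE.
  set (E := Cexp (Ci * RtoC x)) in *; set (F := Cexp (- Ci * RtoC x)) in *.
  rewrite (surjective_pairing (psi x)) at 1; f_equal;
  ring [Ci_sqr HE RtoC_half].
Qed.

Lemma rotated_solves (A : R) (lam : C) (p q : R -> C) :
  rotated_system Ci (RtoC A) lam p q ->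
  solves_schrodinger (rotating_potential A) lam (unrotate p q).
Proof.
intros (p1 & p2 & q1 & q2 & D1 & D2 & D3 & D4 & H1 & H2).
destruct (deriv2_exp_mult Ci _ _ _ D1 D2) as [P1 P2].
destruct (deriv2_exp_mult (- Ci)%C _ _ _ D3 D4) as [Q1 Q2].
apply solves_rotating_iff; do 4 eexists.
split; [|split; [|split; [|split]]].
- exact (deriv_scal (RtoC (1/2)) _ _ (deriv_plus _ _ _ _ P1 Q1)).
- exact (deriv_scal (RtoC (1/2)) _ _ (deriv_plus _ _ _ _ P2 Q2)).
- eapply deriv_ext; [| |exact (deriv_scal (RtoC (1/2)) _ _ (deriv_plus _ _ _ _
    (deriv_scal (- Ci)%C _ _ P1) (deriv_scal Ci _ _ Q1)))];
    [intros x; cbn -[Ci RtoC]; ring|reflexivity].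
- exact (deriv_scal (RtoC (1/2)) _ _ (deriv_plus _ _ _ _
    (deriv_scal (- Ci)%C _ _ P2) (deriv_scal Ci _ _ Q2))).
- intros x; cbn beta; rewrite H1, H2, !RtoC_mult, cos_double_Cexp, sin_double_Cexp.
  unfold unrotate; cbn [fst snd]; pose proof (Cexp_Ci_opp x) as HE.
  set (E := Cexp (Ci * RtoC x)) in *; set (F := Cexp (- Ci * RtoC x)) in *.
  split; ring [Ci_sqr HE RtoC_half].
Qed.

(** * Characteristic roots of the rotated system *)

Definition characteristic_roots (A lam s a b : C) : Prop :=
  (s * s = 4 * lam + A * A)%C /\
  (a * a = - (lam + 1) + s)%C /\ (b * b = - (lam + 1) - s)%C.

Lemma characteristic_roots_exist (A lam : C) :
  exists s a b : C, characteristic_roots A lam s a b.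
Proof.
destruct (Csqrt_exists (4 * lam + A * A)%C) as [s Hs].
destruct (Csqrt_exists (- (lam + 1) + s)%C) as [a Ha].
destruct (Csqrt_exists (- (lam + 1) - s)%C) as [b Hb].
now exists s, a, b.
Qed.

Lemma Cmult_2_reg_l (z : C) : (2 * z = 0)%C -> z = RtoC 0.
Proof.
intros H; transitivity (RtoC (1/2) * (2 * z))%C; [ring [RtoC_half]|].
rewrite H; ring.
Qed.

(** The excluded values come from s^2 = 4 lambda + A^2, a^2 - b^2 = 2s and a^2 b^2 = (lambda - 1 -
    A)(lambda - 1 + A). *)
Lemma characteristic_roots_distinct (A lam s a b : C) :
  characteristic_roots A lam s a b ->
  (4 * lam + A * A)%C <> RtoC 0 -> lam <> (1 + A)%C -> lam <> (1 - A)%C ->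
  s <> RtoC 0 /\ a <> RtoC 0 /\ b <> RtoC 0 /\ (a * a)%C <> (b * b)%C.
Proof.
intros (Hs & Ha & Hb) H0 H1%Cminus_neq_0 H2%Cminus_neq_0.
assert (Hs0 : s <> RtoC 0) by (intros ->; apply H0; rewrite <- Hs; ring).
assert (Hp : (a * a * (b * b))%C <> RtoC 0).
{ rewrite Ha, Hb; intros E; apply (Cmult_neq_0 _ _ H1 H2).
  rewrite <- E; ring [Hs]. }
split; [|split; [|split]]; trivial.
- intros ->; apply Hp; ring.
- intros ->; apply Hp; ring.
- intros E; apply Hs0, Cmult_2_reg_l.
  rewrite Ha, Hb in E.
  transitivity ((- (lam + 1) + s) - (- (lam + 1) - s))%C; [ring|].
  rewrite E; ring.
Qed.

(** Vieta's formulas give the coefficients. They do not involve [e], so the symmetry e -> -e yields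
    the same equation for q. *)
Lemma rotated_system_characteristic (e A lam s a b : C) (p q : R -> C) :
  characteristic_roots A lam s a b -> (e * e = - 1)%C ->
  rotated_system e A lam p q ->
  biquadratic_ode (- (a * a + b * b)) (a * a * (b * b)) p /\
  biquadratic_ode (- (a * a + b * b)) (a * a * (b * b)) q.
Proof.
intros (Hs & Ha & Hb) He H.
replace (- (a * a + b * b))%C with (2 * (lam + 1))%C by (rewrite Ha, Hb; ring).
replace (a * a * (b * b))%C with ((lam - 1) * (lam - 1) - A * A)%C
  by (rewrite Ha, Hb; ring [Hs]).
split; [now apply rotated_system_biquadratic with e q|].
apply rotated_system_biquadratic with (- e)%C p; [ring [He]|].
now apply rotated_system_sym.
Qed.

(** Exponential polynomials absorb coinciding exponents, so every complex [lam] is covered. *)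
Lemma solutions_elementary (A : R) (lam : C) (psi : R -> C * C) :
  solves_schrodinger (rotating_potential A) lam psi ->
  exists E : eformula * eformula, is_branch2 E lam psi.
Proof.
intros (p & q & H & Hpsi)%solves_rotated.
destruct (characteristic_roots_exist (RtoC A) lam) as (s & a & b & Hr).
destruct (rotated_system_characteristic _ _ _ _ _ _ _ _ Hr Ci_sqr H) as [Hp Hq].
apply biquadratic_exp_poly in Hp, Hq.
destruct (exp_poly_elementary lam (fun x => fst (psi x))) as [e1 H1].
{ apply exp_poly_ext with (2 := exp_poly_plus _ _
    (exp_poly_scal_exp (RtoC (1/2)) Ci _ Hp)
    (exp_poly_scal_exp (RtoC (1/2)) (- Ci)%C _ Hq)).
  intros x; rewrite Hpsi; unfold unrotate; cbn [fst snd]; ring. }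
destruct (exp_poly_elementary lam (fun x => snd (psi x))) as [e2 H2].
{ apply exp_poly_ext with (2 := exp_poly_plus _ _
    (exp_poly_scal_exp (RtoC (1/2) * - Ci)%C Ci _ Hp)
    (exp_poly_scal_exp (RtoC (1/2) * Ci)%C (- Ci)%C _ Hq)).
  intros x; rewrite Hpsi; unfold unrotate; cbn [fst snd]; ring. }
now exists (e1, e2).
Qed.

(** * Boundedness for large lambda *)

Definition bounded_fun (f : R -> C) : Prop := exists M, forall x, Cmod (f x) <= M.

Lemma bounded_plus (f g : R -> C) :
  bounded_fun f -> bounded_fun g -> bounded_fun (fun x => f x + g x)%C.
Proof.
intros [M HM] [N HN]; exists (M + N); intros x.
eapply Rle_trans; [apply Cmod_triangle|]; now apply Rplus_le_compat.
Qed.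

Lemma bounded_mult_exp (c k : C) (f : R -> C) :
  Re k = 0 -> bounded_fun f -> bounded_fun (fun x => c * Cexp (k * RtoC x) * f x)%C.
Proof.
intros Hk [M HM]; exists (Cmod c * M); intros x.
rewrite !Cmod_mult, Cmod_Cexp_imag, Rmult_1_r.
- apply Rmult_le_compat_l; [apply Cmod_ge_0|apply HM].
- destruct k as [u v]; cbn in *; rewrite Hk; ring.
Qed.

Lemma bounded_exp_sum (a b : C) (c : nat -> C) (f : R -> C) :
  Re a = 0 -> Re b = 0 ->
  (forall x, f x = sum_n (fun k => c k * Cexp (exponent a b k * RtoC x))%C 3) ->
  bounded_fun f.
Proof.
intros Ha Hb Hf.
(* The constant 1 brings each term c e^(kx) into the shape of [bounded_mult_exp]. *)
assert (H1 : bounded_fun (fun _ => RtoC 1)) by (exists (Cmod 1); intros; lra).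
assert (Hk : forall k, Re (exponent a b k) = 0).
{ destruct a, b; intros [|[|[|k]]]; cbn in *; lra. }
pose proof (fun k => bounded_mult_exp (c k) (exponent a b k) _ (Hk k) H1) as B.
destruct (bounded_plus _ _ (bounded_plus _ _ (bounded_plus _ _
  (B 0%nat) (B 1%nat)) (B 2%nat)) (B 3%nat)) as [M HM].
exists M; intros x; specialize (HM x); rewrite Hf, sum_n_3.
now rewrite !Cmult_1_r in HM.
Qed.

Lemma imaginary_characteristic_roots (A lam : R) :
  1 + Rabs A < lam ->
  exists s alpha beta : R,
    characteristic_roots (RtoC A) (RtoC lam) (RtoC s) (0, alpha) (0, beta).
Proof.
intros Hlam.
assert (HA : A * A = Rabs A * Rabs A) by (rewrite <- Rabs_mult, Rabs_pos_eq; nra).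
pose proof (Rabs_pos A) as H0; set (t := Rabs A) in *.
set (s := sqrt (4 * lam + A * A)).
assert (Hs : s * s = 4 * lam + A * A) by (apply sqrt_sqrt; nra).
assert (Hs0 : 0 <= s) by apply sqrt_pos.
(* Indeed (lambda + 1)^2 - s^2 = (lambda - 1)^2 - A^2 > 0, so both radicands below are positive. *)
assert (Hlt : s < lam + 1) by nra.
exists s, (sqrt (lam + 1 - s)), (sqrt (lam + 1 + s)).
pose proof (sqrt_sqrt (lam + 1 - s) ltac:(lra)) as E1.
pose proof (sqrt_sqrt (lam + 1 + s) ltac:(lra)) as E2.
unfold characteristic_roots, Cminus, RtoC, Cplus, Cmult, Copp; cbn.
repeat split; f_equal; lra.
Qed.

Lemma rotating_maximally_finite_gap (A : R) :
  maximally_finite_gap PI (rotating_potential A).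
Proof.
split; [|split].
- split; [apply PI_RGT_0|]; intros x; unfold rotating_potential.
  replace (2 * (x + PI)) with (2 * x + 2 * PI) by ring.
  now rewrite cos_plus, sin_plus, cos_2PI, sin_2PI, !Rmult_0_r, !Rmult_1_r,
    Rminus_0_r, Rplus_0_r.
- now intros x [|[|i]] [|[|j]] Hi Hj; try lia.
(* Above this threshold the exponents are imaginary, nonzero and distinct, so no powers of x can
   occur. *)
- exists (1 + Rabs A); intros lam _ Hlam psi (p & q & H & Hpsi)%solves_rotated.
  destruct (imaginary_characteristic_roots A lam Hlam) as (s & al & be & Hr).
  destruct (characteristic_roots_distinct _ _ _ _ _ Hr) as (_ & Ha & Hb & Hab).
  + rewrite <- !RtoC_mult, <- RtoC_plus; intros E%RtoC_inj.
    pose proof (Rabs_pos A); nra.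
  + rewrite <- RtoC_plus; intros E%RtoC_inj.
    pose proof (Rle_abs A); lra.
  + rewrite <- RtoC_minus; intros E%RtoC_inj.
    pose proof (Rle_abs (- A)) as HA; rewrite Rabs_Ropp in HA; lra.
  + destruct (rotated_system_characteristic _ _ _ _ _ _ _ _ Hr Ci_sqr H)
      as [Hp Hq].
    destruct (biquadratic_exp_sum _ _ p Ha Hb Hab Hp) as [c Hc].
    destruct (biquadratic_exp_sum _ _ q Ha Hb Hab Hq) as [d Hd].
    apply bounded_exp_sum in Hc, Hd; trivial.
    assert (Hi : Re Ci = 0) by reflexivity.
    assert (Hi' : Re (- Ci)%C = 0) by (cbn; ring).
    destruct (bounded_plus _ _ (bounded_mult_exp (RtoC (1/2)) _ _ Hi Hc)
      (bounded_mult_exp (RtoC (1/2)) _ _ Hi' Hd)) as [M HM].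
    destruct (bounded_plus _ _ (bounded_mult_exp (RtoC (1/2) * - Ci)%C _ _ Hi Hc)
      (bounded_mult_exp (RtoC (1/2) * Ci)%C _ _ Hi' Hd)) as [N HN].
    exists (Rmax M N); intros x; rewrite Hpsi; unfold unrotate; cbn [fst snd].
    split.
    * eapply Rle_trans; [|apply Rmax_l]; eapply Rle_trans; [|apply (HM x)].
      apply Req_le; f_equal; ring.
    * eapply Rle_trans; [|apply Rmax_r]; eapply Rle_trans; [|apply (HN x)].
      apply Req_le; f_equal; ring.
Qed.

(** * Formulas in x and lambda *)

Definition FSqrt (e : eformula) : eformula :=
  EExp (EMul (EConst (RtoC (1/2))) (ELog e)).
Definition FOpp (e : eformula) : eformula := EMul (EConst (- RtoC 1)%C) e.
Definition FExp (e : eformula) : eformula := EExp (EMul e EX).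

Lemma is_branch_add (lam : C) (e1 e2 : eformula) (f g h : R -> C) :
  is_branch e1 lam f -> is_branch e2 lam g -> (forall x, h x = f x + g x)%C ->
  is_branch (EAdd e1 e2) lam h.
Proof. intros H1 H2 H; exists f, g; auto. Qed.

Lemma is_branch_mul (lam : C) (e1 e2 : eformula) (f g h : R -> C) :
  is_branch e1 lam f -> is_branch e2 lam g -> (forall x, h x = f x * g x)%C ->
  is_branch (EMul e1 e2) lam h.
Proof. intros H1 H2 H; exists f, g; auto. Qed.

Lemma is_branch_const (lam : C) (c : C) : is_branch (EConst c) lam (fun _ => c).
Proof. now intros x. Qed.

Lemma is_branch_lambda (lam : C) : is_branch ELambda lam (fun _ => lam).
Proof. now intros x. Qed.

(* Both square roots of a nonzero constant are branches, so the choices made in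
   nested radicals can be coordinated freely. *)
Lemma is_branch_sqrt (lam : C) (e : eformula) (w a : C) :
  a <> RtoC 0 -> (a * a = w)%C -> is_branch e lam (fun _ => w) ->
  is_branch (FSqrt e) lam (fun _ => a).
Proof.
intros Ha <- He; destruct (Clog_exists a Ha) as [z <-].
(* [z] is a logarithm of the wanted root, so 2z is a logarithm of its square, and halving that
   branch returns this root rather than its negative. *)
exists (fun _ => z); split; [|trivial].
exists (fun _ => RtoC (1/2)), (fun _ => (2 * z)%C); split; [|split].
- apply is_branch_const.
- exists (fun _ => (Cexp z * Cexp z)%C); split; [exact He|split].
  + intros x; apply continuous_const.
  + intros _; rewrite <- Cexp_plus; f_equal; ring.
- intros _; ring [RtoC_half].
Qed.

Lemma is_branch_opp (lam : C) (e : eformula) (a : C) :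
  is_branch e lam (fun _ => a) -> is_branch (FOpp e) lam (fun _ => (- a)%C).
Proof.
intros H; apply is_branch_mul with (1 := is_branch_const _ _) (2 := H).
intros _; ring.
Qed.

Lemma is_branch_exp (lam : C) (e : eformula) (a : C) :
  is_branch e lam (fun _ => a) ->
  is_branch (FExp e) lam (fun x => Cexp (a * RtoC x)).
Proof.
intros H; exists (fun x => a * RtoC x)%C; split; [|trivial].
now exists (fun _ => a), RtoC.
Qed.

Definition FDiscr (A : C) : eformula :=
  FSqrt (EAdd (EMul (EConst (RtoC 4)) ELambda) (EConst (A * A)%C)).
(** Gives a for [sgn] = 1 and b for [sgn] = -1, with the same formula for s under both radicals. *)
Definition FRoot (sgn A : C) : eformula :=
  FSqrt (EAdd (FOpp (EAdd ELambda (EConst (RtoC 1))))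
    (EMul (EConst sgn) (FDiscr A))).
Definition FExponent (A : C) (k : nat) : eformula :=
  match k with
  | 0 => FRoot (RtoC 1) A | 1 => FOpp (FRoot (RtoC 1) A)
  | 2 => FRoot (- RtoC 1)%C A | _ => FOpp (FRoot (- RtoC 1)%C A)
  end.

(** The inner radical takes the branch s in both roots, which keeps a and b consistent. Since s, a
    and b are nonzero, all the radicands have logarithms. *)
Lemma is_branch_exponent (A lam s a b : C) (k : nat) :
  characteristic_roots A lam s a b ->
  s <> RtoC 0 -> a <> RtoC 0 -> b <> RtoC 0 ->
  is_branch (FExponent A k) lam (fun _ => exponent a b k).
Proof.
intros (Hs & Ha & Hb) Hs0 Ha0 Hb0.
assert (Bs : is_branch (FDiscr A) lam (fun _ => s)).
{ apply is_branch_sqrt with (2 := Hs); trivial.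
  apply is_branch_add with (2 := is_branch_const _ _)
    (f := fun _ => (4 * lam)%C); trivial.
  now apply is_branch_mul with (1 := is_branch_const _ _)
    (2 := is_branch_lambda _). }
assert (B : forall sgn w r : C, r <> RtoC 0 -> (r * r = w)%C ->
  (w = - (lam + 1) + sgn * s)%C -> is_branch (FRoot sgn A) lam (fun _ => r)).
{ intros sgn w r Hr Hw ->; apply is_branch_sqrt with (2 := Hw); trivial.
  apply is_branch_add with (f := fun _ => (- (lam + 1))%C)
    (g := fun _ => (sgn * s)%C); trivial.
  - apply is_branch_opp; now apply is_branch_add with
      (1 := is_branch_lambda _) (2 := is_branch_const _ _).
  - now apply is_branch_mul with (1 := is_branch_const _ _) (2 := Bs). }
assert (Ba : is_branch (FRoot (RtoC 1) A) lam (fun _ => a)).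
{ apply B with (2 := Ha); trivial; ring. }
assert (Bb : is_branch (FRoot (- RtoC 1)%C A) lam (fun _ => b)).
{ apply B with (2 := Hb); trivial; ring. }
destruct k as [|[|[|k]]]; cbn [FExponent exponent]; trivial;
  now apply is_branch_opp.
Qed.

(* The constant q/p along a solution with exponent k. *)
Definition ratio (A lam k : C) : C := ((k * k + 2 * Ci * k + (lam - 1)) / A)%C.

Definition FRatio (A : C) (e : eformula) : eformula :=
  EMul (EConst (/ A)%C) (EAdd (EAdd (EMul e e) (EMul (EConst (2 * Ci)%C) e))
    (EAdd ELambda (EConst (- RtoC 1)%C))).

Lemma is_branch_ratio (A lam k : C) (e : eformula) :
  is_branch e lam (fun _ => k) ->
  is_branch (FRatio A e) lam (fun _ => ratio A lam k).
Proof.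
intros H; apply is_branch_mul with (1 := is_branch_const _ _)
  (g := fun _ => (k * k + 2 * Ci * k + (lam - 1))%C).
- apply is_branch_add with (f := fun _ => (k * k + 2 * Ci * k)%C)
    (g := fun _ => (lam - 1)%C); trivial.
  + apply is_branch_add with (f := fun _ => (k * k)%C)
      (g := fun _ => (2 * Ci * k)%C); trivial.
    * now apply is_branch_mul with (1 := H) (2 := H).
    * now apply is_branch_mul with (1 := is_branch_const _ _) (2 := H).
  + now apply is_branch_add with (1 := is_branch_lambda _)
      (2 := is_branch_const _ _).
- intros _; unfold ratio, Cdiv; ring.
Qed.

Definition FUnrotate (e1 e2 : eformula) : eformula * eformula :=
  (EMul (EConst (RtoC (1/2))) (EAdd (EMul (FExp (EConst Ci)) e1)
     (EMul (FExp (EConst (- Ci)%C)) e2)),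
   EMul (EConst (RtoC (1/2))) (EAdd
     (EMul (EMul (EConst (- Ci)%C) (FExp (EConst Ci))) e1)
     (EMul (EMul (EConst Ci) (FExp (EConst (- Ci)%C))) e2))).

Lemma is_branch_unrotate (lam : C) (e1 e2 : eformula) (p q : R -> C) :
  is_branch e1 lam p -> is_branch e2 lam q ->
  is_branch2 (FUnrotate e1 e2) lam (unrotate p q).
Proof.
intros H1 H2.
pose proof (is_branch_exp lam _ _ (is_branch_const lam Ci)) as E.
pose proof (is_branch_exp lam _ _ (is_branch_const lam (- Ci)%C)) as F.
split; cbn [fst snd FUnrotate unrotate];
  eapply is_branch_mul; try apply is_branch_const; try reflexivity;
  (eapply is_branch_add; [| |reflexivity]);
  eapply is_branch_mul; try eassumption; try reflexivity;
  (eapply is_branch_mul; [apply is_branch_const|eassumption|reflexivity]).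
Qed.

(** * Exponential solutions for nonzero A *)

Definition exp_solution (A lam k : C) : R -> C * C :=
  unrotate (fun x => Cexp (k * RtoC x))
           (fun x => ratio A lam k * Cexp (k * RtoC x))%C.

(** This is the determinant condition (z^2 + 2iz + lambda - 1)(z^2 - 2iz + lambda - 1) = A^2 of the
    rotated system, multiplied out. *)
Lemma exponent_root (A lam s a b : C) (k : nat) :
  characteristic_roots A lam s a b ->
  let z := exponent a b k in
  ((z * z + lam - 1) * (z * z + lam - 1) + 4 * (z * z) = A * A)%C.
Proof.
intros (Hs & Ha & Hb) z.
assert (Hz : (z * z = a * a)%C \/ (z * z = b * b)%C).
{ unfold z; destruct k as [|[|[|k]]]; cbn [exponent];
  [left|left|right|right]; ring. }
destruct Hz as [-> | ->]; [rewrite Ha|rewrite Hb]; ring [Hs].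
Qed.

(** The equation for p fixes the ratio q/p; the equation for q then amounts to the characteristic
    equation. *)
Lemma exp_rotated_system (A lam k : C) :
  A <> RtoC 0 ->
  ((k * k + lam - 1) * (k * k + lam - 1) + 4 * (k * k) = A * A)%C ->
  rotated_system Ci A lam (fun x => Cexp (k * RtoC x))
    (fun x => ratio A lam k * Cexp (k * RtoC x))%C.
Proof.
intros HA Hk; pose proof (deriv_Cexp k) as D.
pose proof (deriv_scal k _ _ D) as D'.
do 4 eexists; split; [exact D|split; [exact D'|split; [exact (deriv_scal _ _ _ D)|
  split; [exact (deriv_scal _ _ _ D')|split]]]]; intros x; cbn beta.
- unfold ratio; field; trivial.
- assert (Hr : (ratio A lam k * (k * k - 2 * Ci * k + (lam - 1)) = A)%C).
  { unfold ratio.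
    transitivity (((k * k + lam - 1) * (k * k + lam - 1) + 4 * (k * k)
      - 4 * (Ci * Ci + 1) * (k * k)) / A)%C; [now field|].
    rewrite Hk, Ci_sqr; now field. }
  (* The fourth occurrence of [A] is the coefficient of p; the first three sit inside [ratio]. *)
  rewrite <- Hr at 4; ring.
Qed.

(** For spanning, p is a sum of four exponentials, and its equation divided by [A] determines q with
    the same coefficients. *)
Lemma exp_fundamental_system (A : R) (lam s a b : C) :
  A <> 0 -> characteristic_roots (RtoC A) lam s a b ->
  a <> RtoC 0 -> b <> RtoC 0 -> (a * a)%C <> (b * b)%C ->
  fundamental_system (rotating_potential A) lam
    (fun k => exp_solution (RtoC A) lam (exponent a b k)).
Proof.
intros HA Hr Ha Hb Hab.
assert (HA' : RtoC A <> RtoC 0) by (now intros E%RtoC_inj).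
split.
- intros k _; apply rotated_solves, exp_rotated_system; trivial.
  exact (exponent_root _ _ _ _ _ k Hr).
- intros psi (p & q & H & Hpsi)%solves_rotated.
  destruct (rotated_system_characteristic _ _ _ _ _ _ _ _ Hr Ci_sqr H) as [Hp _].
  destruct (biquadratic_exp_sum a b p Ha Hb Hab Hp) as [c Hc].
  destruct H as (p1 & p2 & q1 & q2 & D1 & D2 & _ & _ & H1 & _).
  set (t := fun (k : nat) (x : R) => (c k * Cexp (exponent a b k * RtoC x))%C).
  set (kk := exponent a b) in *.
  assert (Dt : forall k, deriv (t k) (fun x => kk k * t k x)%C).
  { intros k; eapply deriv_ext; [| |exact (deriv_scal (c k) _ _ (deriv_Cexp (kk k)))];
    intros x; unfold t; cbn beta; fold kk; ring. }
  (* Uniqueness of derivatives identifies p', and then p'', with the termwise derivatives of the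
     sum. *)
  assert (E1 : forall x, p1 x = (kk 0%nat * t 0%nat x + kk 1%nat * t 1%nat x
    + kk 2%nat * t 2%nat x + kk 3%nat * t 3%nat x)%C).
  { apply (deriv_unique p); trivial.
    eapply deriv_ext; [| |exact (deriv_plus _ _ _ _ (deriv_plus _ _ _ _
      (deriv_plus _ _ _ _ (Dt 0%nat) (Dt 1%nat)) (Dt 2%nat)) (Dt 3%nat))];
      [|reflexivity].
    intros x; cbn beta; rewrite Hc, sum_n_3; reflexivity. }
  assert (E2 : forall x, p2 x = (kk 0%nat * (kk 0%nat * t 0%nat x)
    + kk 1%nat * (kk 1%nat * t 1%nat x)
    + kk 2%nat * (kk 2%nat * t 2%nat x) + kk 3%nat * (kk 3%nat * t 3%nat x))%C).
  { apply (deriv_unique p1); trivial.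
    eapply deriv_ext; [| |exact (deriv_plus _ _ _ _ (deriv_plus _ _ _ _
      (deriv_plus _ _ _ _ (deriv_scal (kk 0%nat) _ _ (Dt 0%nat))
        (deriv_scal (kk 1%nat) _ _ (Dt 1%nat)))
        (deriv_scal (kk 2%nat) _ _ (Dt 2%nat)))
        (deriv_scal (kk 3%nat) _ _ (Dt 3%nat)))];
      [|reflexivity].
    intros x; cbn beta; now rewrite E1. }
  assert (Hq : forall x, q x = sum_n (fun k => ratio (RtoC A) lam (kk k) * t k x)%C 3).
  { intros x; rewrite sum_n_3.
    transitivity ((p2 x + 2 * Ci * p1 x + (lam - 1) * p x) / RtoC A)%C.
    - rewrite H1; now field.
    - rewrite E2, E1, Hc, sum_n_3; fold (t 0%nat x) (t 1%nat x) (t 2%nat x) (t 3%nat x).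
      unfold ratio; now field. }
  exists c; intros x; rewrite Hpsi; unfold exp_solution, unrotate; cbn [fst snd].
  rewrite Hq, Hc, !sum_n_3; unfold t; fold kk; split; ring.
Qed.

(** * The decoupled case A = 0 *)

Lemma harmonic_ode (l : C) (f f1 f2 : R -> C) :
  l <> RtoC 0 -> deriv f f1 -> deriv f1 f2 -> (forall x, f2 x = l * l * f x)%C ->
  exists c d : C, forall x,
    f x = (c * Cexp (l * RtoC x) + d * Cexp (- l * RtoC x))%C.
Proof.
intros Hl D1 D2 H.
(* f' + l f and f' - l f solve first-order equations with exponents l and -l; their difference is 2
   l f. *)
destruct (exp_ode l _ _ (deriv_plus _ _ _ _ D2 (deriv_scal l _ _ D1)))
  as [c Hc]; [intros x; cbn beta; rewrite H; ring|].
destruct (exp_ode (- l)%C _ _ (deriv_plus _ _ _ _ D2 (deriv_scal (- l)%C _ _ D1)))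
  as [d Hd]; [intros x; cbn beta; rewrite H; ring|].
exists (c / (2 * l))%C, (- d / (2 * l))%C; intros x.
cbn beta in *.
transitivity (((f1 x + l * f x) - (f1 x + - l * f x)) / (2 * l))%C.
- field; repeat split; trivial; intros E%RtoC_inj; lra.
- rewrite Hc, Hd; field; repeat split; trivial; intros E%RtoC_inj; lra.
Qed.

(* For A = 0 the two components decouple and the ratio q/p is undetermined, so
   this case needs its own fundamental system. *)
Definition free_solution (l : C) (k : nat) (x : R) : C * C :=
  match k with
  | 0 => (Cexp (l * RtoC x), RtoC 0) | 1 => (Cexp (- l * RtoC x), RtoC 0)
  | 2 => (RtoC 0, Cexp (l * RtoC x)) | _ => (RtoC 0, Cexp (- l * RtoC x))
  end%C.

Lemma free_fundamental_system (lam l : C) :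
  l <> RtoC 0 -> (l * l = - lam)%C ->
  fundamental_system (rotating_potential 0) lam (free_solution l).
Proof.
intros Hl Hlam; split.
- assert (D : forall m : C,
    deriv (fun x => Cexp (m * RtoC x)) (fun x => m * Cexp (m * RtoC x))%C /\
    deriv (fun x => m * Cexp (m * RtoC x))%C
      (fun x => m * (m * Cexp (m * RtoC x)))%C).
  { intros m; split; [|apply deriv_scal]; apply deriv_Cexp. }
  destruct (D l) as [P1 P2], (D (- l)%C) as [N1 N2].
  pose proof (deriv_const (RtoC 0)) as Z.
  intros k _; apply solves_rotating_iff.
  destruct k as [|[|[|k]]]; do 4 eexists;
    (split; [first [exact P1|exact N1|exact Z]|]);
    (split; [first [exact P2|exact N2|exact Z]|]);
    (split; [first [exact P1|exact N1|exact Z]|]);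
    (split; [first [exact P2|exact N2|exact Z]|]);
    intros x; cbn [free_solution fst snd]; rewrite !Rmult_0_l;
    split; ring [Hlam].
- intros psi (u1 & u2 & v1 & v2 & D1 & D2 & D3 & D4 & H)%solves_rotating_iff.
  destruct (harmonic_ode l _ _ _ Hl D1 D2) as (c0 & c1 & Hc).
  { intros x; destruct (H x) as [-> _]; rewrite !Rmult_0_l; ring [Hlam]. }
  destruct (harmonic_ode l _ _ _ Hl D3 D4) as (c2 & c3 & Hd).
  { intros x; destruct (H x) as [_ ->]; rewrite !Rmult_0_l; ring [Hlam]. }
  exists (fun k => match k with 0 => c0 | 1 => c1 | 2 => c2 | _ => c3 end).
  intros x; rewrite Hc, Hd, !sum_n_3; cbn [free_solution fst snd]; split; ring.
Qed.

Definition FFree (k : nat) : eformula * eformula :=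
  let w := FSqrt (FOpp ELambda) in
  match k with
  | 0 => (FExp w, EConst (RtoC 0)) | 1 => (FExp (FOpp w), EConst (RtoC 0))
  | 2 => (EConst (RtoC 0), FExp w) | _ => (EConst (RtoC 0), FExp (FOpp w))
  end.

Lemma is_branch_free (lam l : C) (k : nat) :
  l <> RtoC 0 -> (l * l = - lam)%C ->
  is_branch2 (FFree k) lam (free_solution l k).
Proof.
intros Hl Hlam.
assert (B : is_branch (FSqrt (FOpp ELambda)) lam (fun _ => l)).
{ apply is_branch_sqrt with (2 := Hlam); trivial.
  apply is_branch_opp, is_branch_lambda. }
pose proof (is_branch_exp _ _ _ B) as P.
pose proof (is_branch_exp _ _ _ (is_branch_opp _ _ _ B)) as N.
pose proof (is_branch_const lam (RtoC 0)) as Z.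
destruct k as [|[|[|k]]]; split; assumption.
Qed.

Theorem proposition2 (A : R) :
  maximally_finite_gap PI (rotating_potential A) /\
  elementary_eigenfunctions (rotating_potential A).
Proof.
split; [apply rotating_maximally_finite_gap|].
split; [apply solutions_elementary|].
destruct (Req_dec A 0) as [->|HA].
(* At lambda = 0 the exponents l and -l coincide. *)
- exists FFree, (RtoC 0 :: nil); intros lam Hlam.
  destruct (Csqrt_exists (- lam)%C) as [l Hl].
  assert (Hl0 : l <> RtoC 0).
  { intros ->; apply Hlam; left.
    transitivity (- - lam)%C; [rewrite <- Hl|]; ring. }
  exists (free_solution l); split.
  + intros k _; now apply is_branch_free.
  + now apply free_fundamental_system.
(* The formulas are fixed before lambda; for each lambda, roots s, a, b are then picked and shown to
   be branches. The excluded values are -A^2/4, where s = 0, and 1 +- A, where a b = 0. *)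
- exists (fun k => FUnrotate (FExp (FExponent (RtoC A) k))
      (EMul (FRatio (RtoC A) (FExponent (RtoC A) k)) (FExp (FExponent (RtoC A) k)))),
    ((- (RtoC A * RtoC A) / 4) :: (1 + RtoC A) :: (1 - RtoC A) :: nil)%C.
  intros lam Hlam.
  destruct (characteristic_roots_exist (RtoC A) lam) as (s & a & b & Hr).
  destruct (characteristic_roots_distinct _ _ _ _ _ Hr) as (Hs & Ha & Hb & Hab).
  + intros E; apply Hlam; left.
    assert (H4 : RtoC 4 <> RtoC 0) by (intros E4%RtoC_inj; lra).
    transitivity ((4 * lam + RtoC A * RtoC A - RtoC A * RtoC A) / 4)%C;
      [rewrite E|]; now field.
  + intros ->; apply Hlam; right; now left.
  + intros ->; apply Hlam; right; right; now left.
  + exists (fun k => exp_solution (RtoC A) lam (exponent a b k)); split.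
    * intros k _; pose proof (is_branch_exponent _ _ _ _ _ k Hr Hs Ha Hb) as B.
      pose proof (is_branch_exp _ _ _ B) as BE.
      apply is_branch_unrotate; trivial.
      now apply is_branch_mul with (1 := is_branch_ratio _ _ _ _ B) (2 := BE).
    * now apply exp_fundamental_system with s.
Qed.
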